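(* Let $k\ge 0$ be an integer and let $s\in\mathbb{C}\setminus\mathbb{Z}$. For integers $0\le l\le j$ put $$S(j,l):=\sum_{\substack{(r_0,\dots,r_l)\in\mathbb{N}_0^{l+1}\\ r_0+\cdots+r_l=j-l}}\ \prod_{h=0}^{l}(2h+1)^{2r_h}.$$ Then $$\frac{d^{2k}}{ds^{2k}}\big(\cot(\pi s)\big)=\pi^{2k}\sum_{0\le l\le j\le k}\left\{\binom{2k}{2j}(2l)!-\binom{2k}{2j+1}(2l+1)!\right\}S(j,l)\,\frac{(-1)^{k-l}\cos(\pi s)}{\sin^{2l+1}(\pi s)},$$ and $$\frac{d^{2k+1}}{ds^{2k+1}}\big(\cot(\pi s)\big)=\pi^{2k+1}\sum_{1\le l\le j\le k+1}\left\{\binom{2k+2}{2j}(2l-1)!-\binom{2k+2}{2j+1}(2l-1)!(2l+1)\right\}S(j,l)\,\frac{(-1)^{k-l}}{\sin^{2l}(\pi s)}.$$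
   Context: $\mathbb{N}_0$ denotes the set of nonnegative integers; $\binom{n}{k}=\frac{n!}{k!(n-k)!}$ for $0\le k\le n$ and $\binom{n}{k}=0$ if $k>n$; $x^0=1$. *)

(* Defs.v *)
From HB Require Import structures.
From mathcomp Require Import all_boot all_order all_algebra.
From mathcomp Require Import complex.
From mathcomp Require Import all_classical all_reals all_analysis.

Set Implicit Arguments.
Unset Strict Implicit.
Unset Printing Implicit Defensive.

Import Order.TTheory GRing.Theory Num.Theory.
Import numFieldNormedType.Exports.

Local Open Scope ring_scope.
Local Open Scope complex_scope.

Definition cexp (R : realType) (z : R[i]) : R[i] :=
  (expR (complex.Re z))%:C *
  (cos (complex.Im z) +i* sin (complex.Im z)).

Definition ccos (R : realType) (z : R[i]) : R[i] :=
  (cexp ('i%C * z) + cexp (- ('i%C * z))) / 2.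

Definition csin (R : realType) (z : R[i]) : R[i] :=
  (cexp ('i%C * z) - cexp (- ('i%C * z))) / (2 * 'i%C).

Definition ccot (R : realType) (z : R[i]) : R[i] := ccos z / csin z.

(* [R[i]] packaged as a field: the normed-module structure over itself used by
   complex derivatives is found on the carrier of a [numFieldType], not on
   [R[i]] directly. *)
Definition CC (R : realType) : numFieldType := R[i].

Definition cotpi (R : realType) (s : CC R) : CC R := ccot (pi%:C * s).

(* S(j, l). Each entry of a tuple of naturals with sum [j - l] is at most
   [j - l], so the tuples are functions into the finite type ['I_(j - l).+1]. *)
Definition Sjl (j l : nat) : nat :=
  (\sum_(r : {ffun 'I_l.+1 -> 'I_(j - l).+1} | \sum_(h < l.+1) r h == j - l)
    \prod_(h < l.+1) (2 * h + 1) ^ (2 * r h))%N.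

(* Main.v *)
Require Import Defs.
From mathcomp Require Import all_boot all_order all_algebra.
From mathcomp Require Import complex.
From mathcomp Require Import all_classical all_reals all_analysis.
From mathcomp Require Import ring lra zify.
Import Order.TTheory GRing.Theory Num.Theory.
Import numFieldNormedType.Exports.
Local Open Scope ring_scope.
Local Open Scope complex_scope.
Local Open Scope classical_set_scope.

(** Write [c = cos (pi z)] and [s = sin (pi z)]. Since [c^2 + s^2 = 1], the
    derivative of [c / s^(n+1)] is [pi (n / s^n - (n+1) / s^(n+2))], so the
    [2k]-th derivative of [c / s] is a combination of the [c / s^(2l+1)] whose
    coefficients, up to sign and the factor [(2l)!], obey
    [D (k+1) l = (2l)^2 D k l + D k (l-1)].  The numbers
    [D k l = sum_j (C(2k,2j) - (2l+1) C(2k,2j+1)) S(j,l)] obey the same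
    recurrence: Pascal's rule and
    [S(j+1,l) = S(j,l-1) + (2l+1)^2 S(j,l)] for complete symmetric sums give it
    directly.  (In terms of generating functions,
    [sum_j S(j,l) x^(2j+1) / (2j+1)! = sinh^(2l+1) x / (2l+1)!] and the formula
    for [D] is [cosh^2 - sinh^2 = 1].) *)

(** * The coefficients *)

(** Complete homogeneous symmetric sum of degree [d] in [a 0, ..., a (n-1)]. The exponent bound [b]
    keeps the index type finite and is separate from [d], so that [d] can vary while the type stays
    fixed. *)
Definition hsym (a : nat -> nat) (n b d : nat) : nat :=
  (\sum_(r : {ffun 'I_n -> 'I_b.+1} | \sum_(h < n) r h == d)
    \prod_(h < n) a h ^ r h)%N.

Definition geom_poly (a b : nat) : {poly nat} := \poly_(i < b.+1) (a ^ i)%N.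

(** Expanding a product of truncated geometric series gives one monomial per exponent function [r],
    of degree the sum of the [r h]. *)
Lemma hsym_coef a n b d :
  hsym a n b d = (\prod_(h < n) geom_poly (a h) b)`_d.
Proof.
have -> : \prod_(h < n) geom_poly (a h) b =
    \prod_(h < n) \sum_(i < b.+1) (a h ^ i)%N%:P * 'X^i.
  apply: eq_bigr => h _; rewrite /geom_poly poly_def.
  by apply: eq_bigr => i _; rewrite mul_polyC.
rewrite bigA_distr_bigA /= coef_sum /hsym big_mkcond /=.
apply: eq_bigr => r _.
rewrite big_split /= -rmorph_prod /= prodrXr coefCM coefXn eq_sym.
by case: eqP => _; rewrite ?mulr1 ?mulr0.
Qed.

Lemma hsymS a n b d : (d <= b)%N ->
  hsym a n.+1 b d = (\sum_(i < d.+1) hsym a n b (d - i) * a n ^ i)%N.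
Proof.
move=> db; rewrite hsym_coef big_ord_recr coefM /=.
(* Reversal makes [i] the exponent of the last variable; [i <= d <= b] keeps it below the
   truncation. *)
rewrite (reindex_inj rev_ord_inj) /=; apply: eq_bigr => i _.
rewrite subSS hsym_coef coef_poly subKn ?ltnS ?(leq_trans (leq_subr _ _)) //.
  by rewrite (leq_trans _ db) // -ltnS.
by rewrite -ltnS.
Qed.

Lemma hsym0 a b d : hsym a 0 b d = (d == 0%N).
Proof. by rewrite hsym_coef big_ord0 coef1; case: eqP. Qed.

Lemma hsym_widen a n b d : (d <= b)%N -> hsym a n b d = hsym a n d d.
Proof.
elim: n b d => [|n IH] b d db; first by rewrite !hsym0.
rewrite !hsymS //; apply: eq_bigr => i _.
by rewrite IH ?(leq_trans (leq_subr _ _)) // [in RHS]IH ?leq_subr.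
Qed.

(** The term with last exponent zero is split off; every other term releases one factor [a n]. *)
Lemma hsym_rec a n d :
  hsym a n.+1 d.+1 d.+1 = (hsym a n d.+1 d.+1 + a n * hsym a n.+1 d d)%N.
Proof.
rewrite !hsymS // big_ord_recl subn0 expn0 muln1 big_distrr /=; congr addn.
apply: eq_bigr => i _; rewrite /bump add1n subSS expnS mulnCA.
by rewrite hsym_widen 1?[in RHS]hsym_widen ?leq_subr ?(leq_trans (leq_subr _ _)).
Qed.

Lemma hsym_d0 a n : hsym a n 0 0 = 1%N.
Proof. by elim: n => [|n IH]; rewrite ?hsym0 // hsymS // big_ord1 IH. Qed.

(* [Sjl j l] is not [0] but [1] for [j < l], because of truncated subtraction. *)
Definition Snum (j l : nat) : nat := if (l <= j)%N then Sjl j l else 0%N.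

Lemma Sjl_hsym j l :
  Sjl j l = hsym (fun h => (2 * h + 1) ^ 2)%N l.+1 (j - l) (j - l).
Proof.
by apply: eq_bigr => r _; apply: eq_bigr => h _; rewrite -expnM.
Qed.

Lemma Snum_small j l : (j < l)%N -> Snum j l = 0%N.
Proof. by rewrite /Snum ltnNge => /negbTE ->. Qed.

Lemma Snum00 : Snum 0 0 = 1%N.
Proof. by rewrite /Snum Sjl_hsym hsym_d0. Qed.

Lemma SnumS0 j : Snum j.+1 0 = Snum j 0.
Proof.
by rewrite /Snum !leq0n !Sjl_hsym !subn0 hsym_rec hsym0 muln0 add0n exp1n mul1n.
Qed.

(** The zero convention above the diagonal makes the recurrence hold for all [j] and [l]; on the
    diagonal both sides are 1. *)
Lemma SnumSS j l :
  Snum j.+1 l.+1 = (Snum j l + (2 * l.+1 + 1) ^ 2 * Snum j l.+1)%N.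
Proof.
rewrite /Snum ltnS; case: (ltngtP l j) => [lj|_|->].
- rewrite !Sjl_hsym subSS; have -> : (j - l = (j - l.+1).+1)%N by lia.
  exact: hsym_rec.
- by rewrite muln0.
- by rewrite muln0 addn0 !Sjl_hsym !subnn !hsym_d0.
Qed.

(** * Binomial transforms of [S(j,l)] and the recurrence of the coefficients *)

Section BinomialTransforms.
Variable K : comNzRingType.
Implicit Types n l j : nat.

(** Defined for [n] of either parity, so that Pascal's rule can advance [n] by one; the binomials
    vanish well before the end of the range. *)
Definition evenbin n l : K :=
  \sum_(j < n.+1) 'C(n, 2 * j)%:R * (Snum j l)%:R.
Definition oddbin n l : K :=
  \sum_(j < n.+1) 'C(n, 2 * j + 1)%:R * (Snum j l)%:R.
Definition cotcoef n l : K := evenbin n l - (2 * l + 1)%:R * oddbin n l.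

Lemma big_ord_narrow_eq0 N n (F : nat -> K) :
    (forall j, (minn N n <= j)%N -> F j = 0) ->
  \sum_(j < N) F j = \sum_(j < n) F j.
Proof.
wlog Nn : N n / (N <= n)%N => [H F0|].
  have [/H->//|/ltnW nN] := leqP N n.
  by apply/esym/H => // j; rewrite minnC; exact: F0.
rewrite (minn_idPl Nn) => F0; rewrite -!(big_mkord xpredT) /=.
rewrite (@big_cat_nat _ _ _ N 0 n) //= [X in _ + X]big_nat_cond.
by rewrite [X in _ + X]big1 ?addr0 // => j /andP[/andP[/F0]].
Qed.

Lemma evenbinE N n l : (n <= 2 * N)%N ->
  evenbin n l = \sum_(j < N.+1) 'C(n, 2 * j)%:R * (Snum j l)%:R.
Proof.
move=> nN; apply: (@big_ord_narrow_eq0 _ _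
  (fun j => 'C(n, 2 * j)%:R * (Snum j l)%:R)) => j jn.
by rewrite bin_small ?mul0r //; lia.
Qed.

Lemma oddbinE N n l : (n <= 2 * N)%N ->
  oddbin n l = \sum_(j < N) 'C(n, 2 * j + 1)%:R * (Snum j l)%:R.
Proof.
move=> nN; apply: (@big_ord_narrow_eq0 _ _
  (fun j => 'C(n, 2 * j + 1)%:R * (Snum j l)%:R)) => j jn.
by rewrite bin_small ?mul0r //; lia.
Qed.

Lemma oddbinS n l : oddbin n.+1 l = oddbin n l + evenbin n l.
Proof.
rewrite (@oddbinE n.+2) 1?(@oddbinE n.+2 n) ?(@evenbinE n.+1 n); try lia.
rewrite -big_split; apply: eq_bigr => j _ /=.
by rewrite addn1 binS natrD mulrDl.
Qed.

(** Pascal's rule on [C(n+1,2j)], with [j] shifted by one in the second half so that the recurrence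
    of [Snum] in its first index applies. *)
Lemma evenbinS_split n l : evenbin n.+1 l =
  evenbin n l + \sum_(j < n.+1) 'C(n, 2 * j + 1)%:R * (Snum j.+1 l)%:R.
Proof.
rewrite (@evenbinE n.+1) ?(@evenbinE n.+1 n); try lia.
rewrite !(big_ord_recl n.+1) /= muln0 !bin0 -addrA; congr (_ + _).
rewrite -big_split; apply: eq_bigr => j _ /=.
by rewrite /bump add1n mulnS addn1 !add2n binS natrD mulrDl addrC.
Qed.

Lemma evenbinS0 n : evenbin n.+1 0 = evenbin n 0 + oddbin n 0.
Proof.
by rewrite evenbinS_split; under eq_bigr do rewrite SnumS0.
Qed.

Lemma evenbinSS n l : evenbin n.+1 l.+1 =
  evenbin n l.+1 + oddbin n l + (2 * l.+1 + 1)%:R ^+ 2 * oddbin n l.+1.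
Proof.
rewrite evenbinS_split -addrA; congr (_ + _).
rewrite /oddbin mulr_sumr -big_split.
apply: eq_bigr => j _ /=; rewrite SnumSS natrD natrM natrX; ring.
Qed.

(** At [l = 0] the factor [2l+1] is 1, and both transforms step to the same sum
    [evenbin n 0 + oddbin n 0]. *)
Lemma cotcoefS0 n : cotcoef n.+1 0 = 0.
Proof. by rewrite /cotcoef evenbinS0 oddbinS muln0 add0n mul1r [oddbin _ _ + _]addrC subrr. Qed.

(** Two one-step recurrences are combined. With [a = 2(l+1)+1], the terms at [l+1] collect the
    factor [1 - 2a + a^2 = (2(l+1))^2], and those at [l] the weight [a - 2 = 2l+1]. *)
Lemma cotcoefSS n l :
  cotcoef n.+2 l.+1 = (2 * l.+1)%:R ^+ 2 * cotcoef n l.+1 + cotcoef n l.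
Proof.
rewrite /cotcoef !(evenbinSS, oddbinS) !natrD !natrM -!natr1; ring.
Qed.

Lemma cotcoef00 : cotcoef 0 0 = 1.
Proof.
rewrite /cotcoef /evenbin /oddbin !big_ord1 Snum00 muln0 bin0.
by rewrite bin_small // mul0r mulr0 subr0 mul1r.
Qed.

Lemma cotcoef_small k l : (k < l)%N -> cotcoef (2 * k) l = 0.
Proof.
move=> kl; rewrite /cotcoef (@evenbinE k) // (@oddbinE k) //.
rewrite !big1 ?mulr0 ?subr0 // => j _; rewrite Snum_small ?mulr0 //.
  by rewrite (ltn_trans _ kl).
by rewrite (leq_ltn_trans _ kl) // -ltnS.
Qed.

Lemma cotcoefE k l : cotcoef (2 * k) l =
  \sum_(j < k.+1) ('C(2 * k, 2 * j)%:R - (2 * l + 1)%:R * 'C(2 * k, 2 * j + 1)%:R)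
    * (Snum j l)%:R.
Proof.
rewrite /cotcoef (@evenbinE k) // (@oddbinE k.+1); last lia.
by rewrite mulr_sumr -sumrB; apply: eq_bigr => j _; rewrite mulrBl mulrA.
Qed.

Lemma sum_triangle_Snum (G : nat -> nat -> K) m n :
  \sum_(m <= j < n) \sum_(m <= l < j.+1) G j l * (Sjl j l)%:R =
  \sum_(m <= l < n) \sum_(m <= j < n) G j l * (Snum j l)%:R.
Proof.
(* The exchange acts on the square on the right; the part of the square outside the triangle
   [l <= j] is zero by [Snum_small]. *)
rewrite exchange_big_nat /=; apply: eq_big_nat => j /andP[mj jn].
rewrite (@big_cat_nat _ _ _ j.+1 m n) //=; last exact: leqW.
rewrite [X in _ + X]big_nat_cond [X in _ + X]big1 ?addr0; last first.
  by move=> l /andP[/andP[jl _] _]; rewrite Snum_small ?mulr0.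
by apply: eq_big_nat => l /andP[_]; rewrite ltnS /Snum => ->.
Qed.

End BinomialTransforms.

(** * Derivatives over a numeric field *)

(** A division-free criterion valid over both the reals and the complex numbers, used to transfer
    real estimates to [cexp]. *)
Lemma is_derive1P (K : numFieldType) (f : K -> K) (x a : K) :
  is_derive x 1 f a <->
  (forall e : K, 0 < e -> exists2 d : K, 0 < d &
    forall h, `|h| < d -> `|f (x + h) - f x - h * a| <= e * `|h|).
Proof.
split=> [[/derivable_nbhs df <-] e e0|H].
  have /eqaddoP /(_ e e0) := df.
  move=> /nbhs_ballP[d /= d0 Hd]; exists d => // h hd.
  have := Hd h; rewrite -ball_normE /= sub0r normrN => /(_ hd).
  rewrite !fctE /= [h%:A]mulr1 [x + h]addrC.
  by congr (`|_| <= _); rewrite opprD addrA.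
suff Hf : h^-1 *: ((f \o shift x) h%:A - f x) @[h --> 0^'] --> a.
  split; first by apply/cvg_ex; exists a.
  exact: cvg_lim Hf.
apply/cvgrPdist_le => e e0; have [d d0 Hd] := H e e0.
rewrite near_withinE; apply/nbhs_ballP; exists d => //= h.
rewrite -ball_normE /= sub0r normrN => hd h0.
rewrite [h%:A]mulr1 [h + x]addrC.
rewrite -[a](mulKf h0) -mulrBr normrM normfV ler_pdivrMl ?normr_gt0//.
by rewrite distrC [`|h| * e]mulrC; exact: Hd.
Qed.

Lemma is_derive_comp1 (K : numFieldType) (f g : K -> K) (x a b : K) :
  is_derive (g x) 1 f a -> is_derive x 1 g b -> is_derive x 1 (f \o g) (a * b).
Proof.
move=> [df <-] [dg <-].
move/derivable1_diffP: (df) => df'; move/derivable1_diffP: (dg) => dg'.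
split; first exact/derivable1_diffP/differentiable_comp.
rewrite -!derive1E derive1E'; last exact/differentiable_comp.
rewrite diff_comp // !derive1E' //= -[X in 'd  _ _ X = _]mulr1.
by rewrite [LHS]linearZ mulrC.
Qed.

Lemma is_deriveV1 (K : numFieldType) (f : K -> K) (x df : K) :
  f x != 0 -> is_derive x 1 f df ->
  is_derive x 1 (fun y => (f y)^-1) (- (f x) ^- 2 * df).
Proof.
by move=> fx0 [dfx <-]; split; [exact: derivableV|rewrite deriveV].
Qed.

(** The induction carries equality on the whole open set, since differentiating once more needs it
    in a neighbourhood. *)
Lemma derive1n_eq_on (K : numFieldType) (U : set K) (f : K -> K)
    (F : nat -> K -> K) :
  open U -> (forall x, U x -> f x = F 0%N x) ->
  (forall n x, U x -> is_derive x 1 (F n) (F n.+1 x)) ->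
  forall n x, U x -> f^`(n) x = F n x /\ is_derive x 1 f^`(n) (F n.+1 x).
Proof.
move=> oU f0 dF n x Ux.
have near_is_derive m : (forall y, U y -> f^`(m) y = F m y) ->
    forall y, U y -> is_derive y 1 f^`(m) (F m.+1 y).
  move=> E y Uy; apply: (@near_eq_is_derive _ _ _ (F m)); last exact: dF.
  by near=> z; rewrite E//; near: z; exact: open_nbhs_nbhs.
suff E m : forall y, U y -> f^`(m) y = F m y.
  by split; [exact: E|exact: near_is_derive (E n) x Ux].
elim: m => [|m IH] y Uy; first exact: f0.
by rewrite derive1nS derive1E; apply: (derive_val (is_derive := near_is_derive m IH y Uy)).
Unshelve. all: by end_near. Qed.

Lemma is_deriveMl (K : numFieldType) (f : K -> K) (x a df : K) :
  is_derive x 1 f df -> is_derive x 1 (fun y => a * f y) (a * df).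
Proof. exact: is_deriveZ. Qed.

Lemma is_derive_sum_pointwise (K : numFieldType) n (h : 'I_n -> K -> K)
    (dh : 'I_n -> K) (x : K) :
  (forall i, is_derive x 1 (h i) (dh i)) ->
  is_derive x 1 (fun y => \sum_(i < n) h i y) (\sum_(i < n) dh i).
Proof.
move=> H; rewrite (_ : (fun y => _) = \sum_(i < n) h i); first exact: is_derive_sum.
by apply/funext => y; rewrite fct_sumE.
Qed.

(** As -1 is its own inverse, the integer exponent [k - l] can be traded for the natural number
    [k + l]. *)
Lemma exprz_subN1 (K : fieldType) (k l : nat) :
  (-1) ^ (k%:Z - l%:Z) = (-1) ^+ (k + l) :> K.
Proof.
rewrite expfzDr ?oppr_eq0 ?oner_eq0 // exprD; congr (_ * _).
by rewrite -exprnN -exprVn invrN1.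
Qed.

(** * The complex exponential *)

Section ComplexExp.
Variable R : realType.
Implicit Types (x y e : R) (z w : CC R).

Lemma cexpD (z w : R[i]) : cexp (z + w) = cexp z * cexp w.
Proof.
case: z w => [a b] [c d]; rewrite /cexp /= expRD cosD sinD.
by apply/eqP; rewrite eq_complex /=; apply/andP; split; apply/eqP; ring.
Qed.

Lemma cexp0 : cexp (0 : R[i]) = 1.
Proof. by rewrite /cexp /= expR0 cos0 sin0 mul1r. Qed.

Lemma expR_cis_approx e : 0 < e -> exists2 d, 0 < d &
  forall x y, `|x| < d -> `|y| < d ->
    `|expR x * cos y - 1 - x| + `|expR x * sin y - y| <= e * (`|x| + `|y|).
Proof.
(* The errors below total [e1 * (|x| + 5|y|)], which [e / 6] covers. *)
move=> e0; pose e1 := e / 6.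
have e10 : 0 < e1 by rewrite /e1; lra.
have [d1 d10 H1] := (is_derive1P _ _ _ _).1 (is_derive_expR (0 : R)) _ e10.
have [d2 d20 H2] := (is_derive1P _ _ _ _).1 (is_derive_cos (0 : R)) _ e10.
have [d3 d30 H3] := (is_derive1P _ _ _ _).1 (is_derive_sin (0 : R)) _ e10.
have /cvgrPdist_lt /(_ _ (ltr01 : (0 : R) < 1)) := @continuous_expR R 0.
move=> /nbhs_ballP[d4 /= d40 H4].
have /cvgrPdist_lt /(_ _ e10) := @continuous_expR R 0.
move=> /nbhs_ballP[d5 /= d50 H5].
(* [d1], [d2], [d3] control the linear approximations of exp, cos and sin at 0; [d4] yields
   [expR x < 2] and [d5] yields [|expR x - 1| < e1]. *)
exists (Num.min (Num.min d1 d2) (Num.min d3 (Num.min d4 d5))); first by rewrite !lt_min d10 d20 d30 d40.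
move=> x y; rewrite !lt_min.
move=> /andP[/andP[x1 x2] /and3P[x3 x4 x5]] /andP[/andP[y1 y2] /and3P[y3 y4 y5]].
have {}H1 := H1 x x1; have {}H2 := H2 y y2; have {}H3 := H3 y y3.
have {}H4 := H4 x; have {}H5 := H5 x.
move: H1 H2 H3 H4 H5; rewrite -!ball_normE /= !sub0r !normrN !add0r.
rewrite expR0 cos0 sin0 oppr0 mulr0 mulr1 mulr1 !subr0 addr0.
move=> H1 H2 H3 /(_ x4) H4 /(_ x5) H5.
have E0 := expR_gt0 x.
have E2 : expR x < 2 by move: H4; rewrite ltr_norml => /andP[]; lra.
have -> : expR x * cos y - 1 - x = expR x * (cos y - 1) + (expR x - 1 - x) by ring.
have -> : expR x * sin y - y = expR x * (sin y - y) + y * (expR x - 1) by ring.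
apply: (@le_trans _ _ ((2 * (e1 * `|y|) + e1 * `|x|) + (2 * (e1 * `|y|) + `|y| * e1))).
  apply: lerD; apply: (le_trans (ler_normD _ _)); apply: lerD => //.
  - by rewrite normrM gtr0_norm //; apply: ler_pM => //; apply: ltW.
  - by rewrite normrM gtr0_norm //; apply: ler_pM => //; apply: ltW.
  - by rewrite normrM distrC; apply: ler_pM => //; apply: ltW.
rewrite /e1; have := normr_ge0 x; have := normr_ge0 y; nra.
Qed.

Lemma normc_ge_Im (z : R[i]) : `|complex.Im z|%:C <= `|z|.
Proof. by have := normc_ge_Re (z * 'i%C); rewrite ReiNIm normrN normrM complexiE normCi mulr1. Qed.

Lemma normc_le_ReIm (z : R[i]) :
  `|z| <= (`|complex.Re z| + `|complex.Im z|)%:C.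
Proof.
rewrite [z in `|z|]complexE (le_trans (ler_normD _ _)) // rmorphD lerD //.
  by rewrite normc_def /= expr0n addr0 sqrtr_sqr.
by rewrite normrM complexiE normCi mul1r normc_def /= expr0n addr0 sqrtr_sqr.
Qed.

Lemma is_derive_cexp0 : is_derive (0 : CC R) 1 (@cexp R : CC R -> CC R) 1.
Proof.
(* A positive element of [R[i]] has zero imaginary part, so [e] reduces to a real number. *)
apply/is_derive1P => e.
case: e => e e'; rewrite ltcE /= => /andP[/eqP-> e0] {e'}.
(* Half of [e], because [|Re h| + |Im h| <= 2|h|]. *)
have [d d0 Hd] := @expR_cis_approx (e / 2) (divr_gt0 e0 (ltr0Sn _ 1)).
exists (d%:C); first by rewrite ltcR.
move=> h hd; rewrite add0r cexp0 mulr1.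
have hx : `|complex.Re h| < d by rewrite -ltcR; apply: le_lt_trans hd; apply: normc_ge_Re.
have hy : `|complex.Im h| < d by rewrite -ltcR; apply: le_lt_trans hd; apply: normc_ge_Im.
apply: (le_trans (normc_le_ReIm _)).
have -> : complex.Re (cexp h - 1 - h) =
   expR (complex.Re h) * cos (complex.Im h) - 1 - complex.Re h.
  by case: h {hd hx hy} => x y; rewrite /cexp /=; ring.
have -> : complex.Im (cexp h - 1 - h) =
   expR (complex.Re h) * sin (complex.Im h) - complex.Im h.
  by case: h {hd hx hy} => x y; rewrite /cexp /=; ring.
apply: (@le_trans _ _ (e / 2 * (`|complex.Re h| + `|complex.Im h|))%:C).
  by rewrite lecR; apply: Hd.
rewrite rmorphM rmorphD /=.
apply: (@le_trans _ _ ((e / 2)%:C * (`|h| + `|h|))).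
  rewrite ler_wpM2l ?ler0c ?divr_ge0 ?(ltW e0) //.
  by apply: lerD; [apply: normc_ge_Re|apply: normc_ge_Im].
by rewrite mulrDr -mulrDl -rmorphD /= -splitr.
Qed.

Lemma is_derive_cexp z : is_derive z 1 (@cexp R : CC R -> CC R) (cexp z).
Proof.
apply/is_derive1P => e e0.
(* The added 1 makes the divisor of [e] visibly positive. *)
have M0 : 0 < `|cexp z : CC R| + 1 by rewrite ltr_wpDl.
have [d d0 Hd] := (is_derive1P _ _ _ _).1 is_derive_cexp0 _ (divr_gt0 e0 M0).
exists d => // h hd; have := Hd h hd.
rewrite add0r cexp0 mulr1 => H.
have -> : cexp (z + h) - cexp z - h * cexp z = (cexp z : CC R) * (cexp h - 1 - h).
  by rewrite cexpD; ring.
rewrite normrM; apply: (@le_trans _ _ (`|cexp z : CC R| * (e / (`|cexp z : CC R| + 1) * `|h|))).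
  exact: ler_wpM2l.
rewrite mulrA ler_wpM2r // mulrA ler_pdivrMr // mulrC ler_wpM2l ?(ltW e0) //.
by rewrite lerDl.
Qed.

Lemma is_derive_cexpM (c z : CC R) :
  is_derive z 1 (fun w : CC R => cexp (c * w) : CC R) (c * cexp (c * z)).
Proof.
rewrite mulrC; apply: (@is_derive_comp1 _ (@cexp R : CC R -> CC R) (fun w => c * w)).
  exact: is_derive_cexp.
by have := @is_deriveZ _ _ _ id c z 1 1 (is_derive_id _ _); rewrite [c%:A]mulr1.
Qed.

End ComplexExp.

(** * Iterated derivatives of the cotangent *)

Section TrigPair.
(** Here [c] and [s] play the roles of [cos (p z)] and [sin (p z)], known through their derivatives
    and the Pythagorean identity. *)
Variables (K : numFieldType) (p : K) (c s : K -> K).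
Implicit Types (z : K) (k l n : nat).
Hypothesis dc : forall z : K, is_derive z 1 c (- p * s z).
Hypothesis ds : forall z : K, is_derive z 1 s (p * c z).
Hypothesis c2s2 : forall z, c z ^+ 2 + s z ^+ 2 = 1.

Lemma is_derive_sXV n z : s z != 0 ->
  is_derive z 1 (fun w => (s w ^+ n)^-1) (- p * n%:R * (c z / s z ^+ n.+1)).
Proof.
move=> sz0; have sn0 : s z ^+ n != 0 by rewrite expf_neq0.
have dX : is_derive z 1 (fun w => s w ^+ n) ((n%:R * s z ^+ n.-1) * (p * c z)).
  by have := @is_deriveX _ _ _ n z 1 _ (ds z); rewrite exprfctE.
have := @is_deriveV1 K (fun w => s w ^+ n) z _ sn0 dX.
(* The case [n = 0] is separate because of the predecessor [n.-1] in the power rule; both sides are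
   then zero. *)
congr is_derive; case: n {dX} sn0 => [|n] sn0; first by rewrite !mul0r !mulr0 ?mul0r.
by rewrite /= !exprS; field; rewrite sz0 expf_neq0.
Qed.

Lemma is_derive_c_sXV n z : s z != 0 ->
  is_derive z 1 (fun w => c w / s w ^+ n.+1)
    (p * (n%:R / s z ^+ n - n.+1%:R / s z ^+ n.+2)).
Proof.
move=> sz0; have sn0 : s z ^+ n != 0 by rewrite expf_neq0.
have := @is_deriveM _ _ _ _ z 1 _ _ (dc z) (is_derive_sXV n.+1 _ sz0).
congr is_derive; rewrite /GRing.scale /=.
have -> : c z * (- p * n.+1%:R * (c z / s z ^+ n.+2)) =
   - p * n.+1%:R * ((1 - s z ^+ 2) / s z ^+ n.+2).
  by rewrite -(c2s2 z) addrK expr2; ring.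
by rewrite !exprS -natr1; field; rewrite sz0 sn0.
Qed.

Definition cot_even k (z : K) : K := p ^+ (2 * k) *
  \sum_(l < k.+1) (-1) ^+ (k + l) * (2 * l)`!%:R * cotcoef K (2 * k) l
    * (c z / s z ^+ (2 * l).+1).

(** The index [l] stands for [l+1] in the stated formula, whence [(2l+1)!] for [(2(l+1)-1)!] and
    binomials of [2k+2]. *)
Definition cot_odd k (z : K) : K := p ^+ (2 * k).+1 *
  \sum_(l < k.+1) (-1) ^+ (k + l.+1) * (2 * l).+1`!%:R
    * cotcoef K (2 * k.+1) l.+1 / s z ^+ (2 * l.+1).

Lemma is_derive_cot_even k z : s z != 0 ->
  is_derive z 1 (cot_even k) (cot_odd k z).
Proof.
move=> sz0.
have := @is_deriveMl _ _ z (p ^+ (2 * k)) _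
  (@is_derive_sum_pointwise _ _ _ _ z (fun l : 'I_k.+1 =>
     @is_deriveMl _ _ z ((-1) ^+ (k + l) * (2 * l)`!%:R * cotcoef K (2 * k) l) _
     (is_derive_c_sXV (2 * l) z sz0))).
congr is_derive; rewrite /cot_odd exprSr -mulrA; congr (_ * _).
(* Each term differentiates into a part [A] with power [2l] and a part [B] with power [2l+2];
   shifting [A] by one aligns the powers, and [cotcoefSS] merges the two. *)
pose A l : K := (-1) ^+ (k + l) * (2 * l)`!%:R * cotcoef K (2 * k) l
  * ((2 * l)%:R / s z ^+ (2 * l)).
pose B l : K := (-1) ^+ (k + l) * (2 * l)`!%:R * cotcoef K (2 * k) l
  * ((2 * l).+1%:R / s z ^+ (2 * l.+1)).
transitivity (p * (\sum_(l < k.+1) A l - \sum_(l < k.+1) B l)).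
  rewrite mulrBr !mulr_sumr -sumrB; apply: eq_bigr => l _.
  by rewrite /A /B mulnS add2n; ring.
(* The shift loses nothing: [A 0] has the factor [2l = 0], and [A k.+1] has a coefficient beyond the
   diagonal. *)
congr (_ * _); have -> : \sum_(l < k.+1) A l = \sum_(l < k.+1) A l.+1.
  have A0 : A 0%N = 0 by rewrite /A muln0 mulr0n mul0r mulr0.
  have Ak : A k.+1 = 0 by rewrite /A cotcoef_small // mulr0 mul0r.
  by rewrite big_ord_recl big_ord_recr /= A0 Ak add0r addr0.
rewrite -sumrB; apply: eq_bigr => l _; rewrite /A /B.
have -> : cotcoef K (2 * k.+1) l.+1 =
    (2 * l.+1)%:R ^+ 2 * cotcoef K (2 * k) l.+1 + cotcoef K (2 * k) l.
  by rewrite [(2 * k.+1)%N]mulnS add2n cotcoefSS.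
have -> : (2 * l.+1)`!%:R = (2 * l.+1)%:R * (2 * l).+1`!%:R :> K.
  by rewrite -natrM mulnS add2n factS.
by rewrite factS addnS exprS; move: (s z ^+ _)^-1 => t; ring.
Qed.

Lemma is_derive_cot_odd k z : s z != 0 ->
  is_derive z 1 (cot_odd k) (cot_even k.+1 z).
Proof.
move=> sz0.
have := @is_deriveMl _ _ z (p ^+ (2 * k).+1) _
  (@is_derive_sum_pointwise _ _ _ _ z (fun l : 'I_k.+1 =>
     @is_deriveMl _ _ z ((-1) ^+ (k + l.+1) * (2 * l).+1`!%:R
       * cotcoef K (2 * k.+1) l.+1) _
     (is_derive_sXV (2 * l.+1) z sz0))).
congr is_derive; rewrite /cot_even [in RHS]big_ord_recl /=.
(* The sum for [k+1] has one more term, at [l = 0], which vanishes; the others match one for one. *)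
have -> : cotcoef K (2 * k.+1) 0 = 0 by rewrite mulnS add2n cotcoefS0.
rewrite mulr0 mul0r add0r [in X in _ = X * _]mulnS add2n [in RHS]exprSr.
rewrite -[RHS]mulrA; congr (_ * _); rewrite mulr_sumr; apply: eq_bigr => l _.
rewrite /bump /= add1n addSn [(-1) ^+ _.+1]exprS.
have -> : (2 * l.+1)`!%:R = (2 * l.+1)%:R * (2 * l).+1`!%:R :> K.
  by rewrite -natrM mulnS add2n factS.
move: (s z ^+ _)^-1 => t; ring.
Qed.

(** Both parities are interleaved into the single sequence that [derive1n_eq_on] expects. *)
Definition cot_form n : K -> K := if odd n then cot_odd n./2 else cot_even n./2.

Lemma cot_form_even k : cot_form (2 * k) = cot_even k.
Proof. by rewrite /cot_form mul2n odd_double doubleK. Qed.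

Lemma cot_form_odd k : cot_form (2 * k).+1 = cot_odd k.
Proof. by rewrite /cot_form mul2n /= odd_double /= uphalf_double. Qed.

Lemma is_derive_cot_form n z : s z != 0 ->
  is_derive z 1 (cot_form n) (cot_form n.+1 z).
Proof.
rewrite -[n]odd_double_half -mul2n; case: (odd n) => sz0.
  rewrite add1n cot_form_odd (_ : (2 * n./2).+2 = (2 * n./2.+1)%N); last lia.
  by rewrite cot_form_even; exact: is_derive_cot_odd.
by rewrite add0n cot_form_odd cot_form_even; exact: is_derive_cot_even.
Qed.

Lemma cot_form0 z : cot_form 0 z = c z / s z.
Proof.
by rewrite (cot_form_even 0) /cot_even big_ord1 !muln0 cotcoef00 !expr0 !mul1r expr1.
Qed.

Lemma open_s_neq0 : open [set z | s z != 0].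
Proof.
have cs : continuous s.
  by move=> z; apply/differentiable_continuous/derivable1_diffP; case: (ds z).
rewrite (_ : [set z | _] = s @^-1` [set w | w != 0]) //.
apply: open_comp; first by move=> z _; exact: cs.
rewrite (_ : [set w | _] = ~` [set 0]).
  exact/closed_openC/accessible_closed_set1/hausdorff_accessible/norm_hausdorff.
by apply/seteqP; split => w /eqP.
Qed.

Lemma derive1n_cot_form n z : s z != 0 ->
  (fun w => c w / s w)^`(n) z = cot_form n z /\
  derivable (fun w => c w / s w)^`(n) z 1.
Proof.
move=> sz0.
have [||->] := @derive1n_eq_on K _ (fun w => c w / s w) cot_form open_s_neq0 _ _ n z sz0.
- by move=> x _; rewrite cot_form0.
- by move=> m x; exact: is_derive_cot_form.
by case.
Qed.

Lemma cot_evenE k z : cot_even k z = p ^+ (2 * k) *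
  \sum_(0 <= j < k.+1) \sum_(0 <= l < j.+1)
    ('C(2 * k, 2 * j)%:R * (2 * l)`!%:R
     - 'C(2 * k, 2 * j + 1)%:R * (2 * l + 1)`!%:R)
    * (Sjl j l)%:R
    * ((-1) ^ (k%:Z - l%:Z) * c z / s z ^+ (2 * l + 1)).
Proof.
congr (_ * _).
(* [S(j,l)] is moved to the end, the shape required by [sum_triangle_Snum]; then
   [(2l+1)! = (2l+1)(2l)!] exposes [cotcoef]. *)
under [RHS]eq_bigr do under eq_bigr do rewrite mulrAC.
rewrite sum_triangle_Snum big_mkord; apply: eq_bigr => l _.
rewrite cotcoefE mulr_sumr mulr_suml big_mkord; apply: eq_bigr => j _.
rewrite exprz_subN1 [(2 * l + 1)%N]addn1 factS natrM -mulrA.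
move: (s z ^+ _)^-1 => t; ring.
Qed.

Lemma cot_oddE k z : cot_odd k z = p ^+ (2 * k + 1) *
  \sum_(1 <= j < k.+2) \sum_(1 <= l < j.+1)
    ('C(2 * k + 2, 2 * j)%:R * (2 * l - 1)`!%:R
     - 'C(2 * k + 2, 2 * j + 1)%:R * (2 * l - 1)`!%:R * (2 * l + 1)%:R)
    * (Sjl j l)%:R
    * ((-1) ^ (k%:Z - l%:Z) / s z ^+ (2 * l)).
Proof.
rewrite addn1; congr (_ * _).
under [RHS]eq_bigr do under eq_bigr do rewrite mulrAC.
rewrite sum_triangle_Snum big_add1 big_mkord; apply: eq_bigr => l _.
(* The term [j = 0] of the coefficient vanishes as [S(0,l+1) = 0], so the outer sum may start at
   1. *)
rewrite cotcoefE big_ord_recl Snum_small // mulr0 add0r big_add1 big_mkord.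
rewrite mulr_sumr mulr_suml; apply: eq_bigr => j _.
rewrite exprz_subN1 (_ : (2 * l.+1 - 1 = (2 * l).+1)%N); last lia.
rewrite (_ : (2 * k + 2 = 2 * k.+1)%N); last lia.
by rewrite lift0; move: (s z ^+ _)^-1 => t; ring.
Qed.

End TrigPair.

(** * Complex sine and cosine, and the zeros of the sine *)

Section ComplexCotangent.
Variable R : realType.
Implicit Types z w : CC R.

Lemma imaginary_neq0 : 'i%C != 0 :> R[i].
Proof. by rewrite eq_complex /= oner_eq0 andbF. Qed.

Lemma is_derive_ccosM (a z : CC R) : is_derive z 1
  (fun w : CC R => ccos (a * w) : CC R) (- a * csin (a * z)).
Proof.
have -> : (fun w : CC R => ccos (a * w) : CC R) = fun w => 2^-1 *
    ((cexp ('i%C * a * w) : CC R) + cexp (- ('i%C * a) * w)).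
  by apply/funext => w; rewrite /ccos mulrA mulNr mulrC.
have := @is_deriveMl _ _ z (2^-1 : CC R) _
  (is_deriveD (is_derive_cexpM R ('i%C * a) z) (is_derive_cexpM R (- ('i%C * a)) z)).
congr is_derive; rewrite /csin ['i%C * (a * z)]mulrA -[- ('i%C * a * z)]mulNr.
have i0 := imaginary_neq0.
(* Reconciles the factor [i] from differentiation with the denominator [2i] of [csin]. *)
have i2 : ('i%C : R[i]) ^-1 = - 'i%C.
  by apply: (mulfI i0); rewrite mulfV // mulrN -expr2 sqr_i opprK.
rewrite invfM i2; move: (cexp _) (cexp _) => E E'; ring.
Qed.

Lemma is_derive_csinM (a z : CC R) : is_derive z 1
  (fun w : CC R => csin (a * w) : CC R) (a * ccos (a * z)).
Proof.
have i0 := imaginary_neq0.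
have -> : (fun w : CC R => csin (a * w) : CC R) = fun w => (2 * 'i%C)^-1 *
    ((cexp ('i%C * a * w) : CC R) - cexp (- ('i%C * a) * w)).
  by apply/funext => w; rewrite /csin mulrA mulNr mulrC.
have := @is_deriveMl _ _ z ((2 * 'i%C)^-1 : CC R) _
  (is_deriveB (is_derive_cexpM R ('i%C * a) z) (is_derive_cexpM R (- ('i%C * a)) z)).
congr is_derive; rewrite /ccos ['i%C * (a * z)]mulrA -[- ('i%C * a * z)]mulNr.
by move: (cexp _) (cexp _) => E E'; field.
Qed.

(** With [E] and [E'] the two exponentials, the sum is [((E+E')^2 - (E-E')^2)/4 = E E' = 1]. *)
Lemma ccos2Dcsin2 (z : R[i]) : ccos z ^+ 2 + csin z ^+ 2 = 1.
Proof.
have E : cexp ('i%C * z) * cexp (- ('i%C * z)) = 1 by rewrite -cexpD subrr cexp0.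
rewrite /ccos /csin !expr_div_n [(2 * _) ^+ 2]exprMn sqr_i mulrN1 invrN mulrN.
by rewrite -mulrBl -[RHS]E; field.
Qed.

(** Were [t] not its floor [m], then [pi (t-m)] would lie strictly between 0 and [pi], where the
    sine is positive, yet its sine is that of [pi t] up to sign. *)
Lemma sin_piM_eq0 (t : R) : sin (pi * t) = 0 -> exists m : int, t = m%:~R.
Proof.
move=> st; exists (Num.floor t); have := floor_itv t.
set m := Num.floor t => /andP[mt tm]; apply/eqP; rewrite eq_le mt andbT leNgt.
apply/negP => lt_mt; pose u := t - m%:~R.
have u01 : 0 < pi * u < pi.
  rewrite mulr_gt0 ?pi_gt0 ?subr_gt0 //= gtr_pMr ?pi_gt0 // ltrBlDl.
  by rewrite -[1]/(1%:~R) -intrD.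
suff su : sin (pi * u) = 0 by have := sin_gt0_pi u01; rewrite su ltxx.
rewrite /u mulrBr; case: m {mt tm lt_mt u u01} => n.
  have := alternatingn (@sinDpi R) n (pi * t - pi * n%:~R).
  rewrite -mulr_natr subrK st => /esym/eqP.
  by rewrite mulf_eq0 signr_eq0 => /eqP.
have := alternatingn (@sinDpi R) n.+1 (pi * t).
by rewrite st mulr0 NegzE mulrNz mulrN opprK mulr_natr.
Qed.

Lemma csin_piM_neq0 (z : R[i]) : (forall m : int, z <> m%:~R) ->
  csin (pi%:C * z) != 0.
Proof.
move=> zZ; apply/eqP.
have i0 : 2 * 'i%C != 0 :> R[i].
  by rewrite mulf_neq0 ?pnatr_eq0 // imaginary_neq0.
move=> /eqP; rewrite mulf_eq0 invr_eq0 (negbTE i0) orbF subr_eq0.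
case: z zZ => t y zZ; rewrite /cexp eq_complex /=.
rewrite !(mul0r, mul1r, subr0, add0r, addr0, sub0r, oppr0).
rewrite opprK cosN sinN.
have E1 := expR_gt0 (- (pi * y)); have E2 := expR_gt0 (pi * y).
move=> /andP[/eqP Hc /eqP Hs].
(* The imaginary parts give [(exp(-pi y) + exp(pi y)) sin(pi t) = 0] with a positive first factor.
   Then [cos(pi t)] is nonzero, and the real parts force [y = 0]. *)
have st : sin (pi * t) = 0 by nra.
have [m tm] := sin_piM_eq0 _ st.
have ct : cos (pi * t) != 0.
  by apply/eqP => c0; have := cos2Dsin2 (pi * t); rewrite st c0; lra.
have /eqP := mulIf ct Hc; rewrite (inj_eq (@expR_inj R)) => /eqP y0.
have {}y0 : y = 0.
  have : pi * y = 0 by lra.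
  by move=> /eqP; rewrite mulf_eq0 gt_eqF ?pi_gt0 //= => /eqP.
apply: (zZ m); rewrite tm y0 -(rmorph_int (real_complex R)).
by [].
Qed.

End ComplexCotangent.

Theorem theorem2p3 (R : realType) (k : nat) (s : CC R)
  (s_nonint : forall m : int, s <> m%:~R) :
  [/\ forall m : nat, (m <= 2 * k)%N -> derivable (@cotpi R)^`(m) s 1,
      (@cotpi R)^`(2 * k) s =
        pi%:C ^+ (2 * k) *
        \sum_(0 <= j < k.+1) \sum_(0 <= l < j.+1)
          ('C(2 * k, 2 * j)%:R * (2 * l)`!%:R
           - 'C(2 * k, 2 * j + 1)%:R * (2 * l + 1)`!%:R)
          * (Sjl j l)%:R
          * ((-1) ^ (k%:Z - l%:Z) * ccos (pi%:C * s)
             / csin (pi%:C * s) ^+ (2 * l + 1))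
    & (@cotpi R)^`(2 * k + 1) s =
        pi%:C ^+ (2 * k + 1) *
        \sum_(1 <= j < k.+2) \sum_(1 <= l < j.+1)
          ('C(2 * k + 2, 2 * j)%:R * (2 * l - 1)`!%:R
           - 'C(2 * k + 2, 2 * j + 1)%:R * (2 * l - 1)`!%:R * (2 * l + 1)%:R)
          * (Sjl j l)%:R
          * ((-1) ^ (k%:Z - l%:Z) / csin (pi%:C * s) ^+ (2 * l))].
Proof.
have sz0 := csin_piM_neq0 R s s_nonint.
have D n := @derive1n_cot_form (CC R) (pi%:C)
  (fun w => ccos (pi%:C * w)) (fun w => csin (pi%:C * w))
  (is_derive_ccosM R _) (is_derive_csinM R _) (fun w => ccos2Dcsin2 R _) n s sz0.
split=> [m _||].
- by have [] := D m.
- by have [-> _] := D (2 * k)%N; rewrite cot_form_even cot_evenE.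
- by have [] := D (2 * k).+1; rewrite cot_form_odd cot_oddE -addn1.
Qed.
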